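(* For all positive integers $b$ and $w$, the limit $$s_{b\times w}=\lim_{n\to\infty}\frac{\log(T_{b\times w}(n))}{n}$$ exists (as a finite real number).
   Context: Let $b,w$ be positive integers. A $b\times w$ block is a subset of $\mathbb{R}^3$ of the form $[x,x+b]\times[y,y+w]\times[z,z+1]$ or $[x,x+w]\times[y,y+b]\times[z,z+1]$ with $x,y,z\in\mathbb{Z}$. A building is a finite set of blocks with pairwise disjoint interiors. Two blocks of a building are attached if their $z$-coordinates differ by exactly $1$ and their projections to the $xy$-plane overlap in a set with nonempty interior (i.e. at least one stud of the lower block is inserted into the upper block). A building is contiguous if the graph on its blocks given by attachment is connected. Two buildings are identified if one is mapped onto the other by a composition of translations of $\mathbb{R}^3$ and rotations about vertical axes (rotations in the $xy$-plane, by multiples of $90^\circ$). $T_{b\times w}(n)$ denotes the number of contiguous buildings consisting of exactly $n$ blocks of dimension $b\times w$, counted up to this identification. *)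

(* Defs.v *)
From mathcomp Require Import all_boot all_order all_algebra finmap.
From mathcomp Require Import all_classical all_reals all_analysis.
From Stdlib Require Import Relation_Operators.

Set Implicit Arguments.
Unset Strict Implicit.
Unset Printing Implicit Defensive.

Import Order.TTheory GRing.Theory Num.Theory.
Import numFieldNormedType.Exports.

Local Open Scope classical_set_scope.
Local Open Scope card_scope.
Local Open Scope ring_scope.

Section Buildings.
Variable R : realType.

(* The coordinates of p are x = p.1.1, y = p.1.2 and z = p.2, so that
   fst : space -> R * R is the projection to the xy-plane. *)
Definition space : Type := (R * R * R)%type.

Definition box (dx dy : nat) (x y z : int) : set space :=
  `[x%:~R, x%:~R + dx%:R] `*` `[y%:~R, y%:~R + dy%:R] `*` `[z%:~R, z%:~R + 1].

Definition block_at_height (b w : nat) (z : int) (A : set space) : Prop :=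
  exists x y : int, A = box b w x y z \/ A = box w b x y z.

Definition is_block (b w : nat) (A : set space) : Prop :=
  exists z : int, block_at_height b w z A.

Definition attached (b w : nat) (A C : set space) : Prop :=
  (exists z z' : int, [/\ block_at_height b w z A,
                          block_at_height b w z' C & `|z - z'| = 1]) /\
  ((fst @` A) `&` (fst @` C) : set (R * R))° !=set0.

Definition is_building (b w : nat) (B : set (set space)) : Prop :=
  [/\ finite_set B,
      forall A, B A -> is_block b w A &
      forall A C, B A -> B C -> A <> C ->
        (A : set (R * R * R))° `&` (C : set (R * R * R))° = set0].

Definition contiguous (b w : nat) (B : set (set space)) : Prop :=
  forall A C, B A -> B C ->
    clos_refl_trans (set space)
      (fun A1 A2 => [/\ B A1, B A2 & attached b w A1 A2]) A C.

Definition contiguous_buildings (b w n : nat) : set (set (set space)) :=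
  [set B | [/\ is_building b w B, B #= `I_n & contiguous b w B]].

Definition translation (v p : space) : space :=
  (p.1.1 + v.1.1, p.1.2 + v.1.2, p.2 + v.2).

(* Rotation by 90 degrees about the vertical axis through (c.1, c.2, 0). *)
Definition quarter_turn (c : R * R) (p : space) : space :=
  (c.1 - (p.1.2 - c.2), c.2 + (p.1.1 - c.1), p.2).

(* Rotations by all multiples of 90 degrees, inverses included, are iterated
   quarter turns, so this is a group of maps. *)
Inductive motion : (space -> space) -> Prop :=
| motion_translation v : motion (translation v)
| motion_quarter_turn c : motion (quarter_turn c)
| motion_comp f g : motion f -> motion g -> motion (f \o g).

Definition identified (B B' : set (set space)) : Prop :=
  exists2 f, motion f & B' = [set f @` A | A in B].

Definition building_class (b w n : nat) (B : set (set space)) :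
    set (set (set space)) :=
  [set B' | contiguous_buildings b w n B' /\ identified B B'].

Definition building_classes (b w n : nat) : set (set (set (set space))) :=
  [set building_class b w n B | B in contiguous_buildings b w n].

(* fset_set sends an infinite set to fset0; for b, w > 0 the set
   building_classes b w n is finite, so num_buildings is its cardinality. *)
Definition num_buildings (b w n : nat) : nat := #|` fset_set (building_classes b w n) |.

End Buildings.

(* Main.v *)
Require Import Defs.
From mathcomp Require Import all_boot all_order all_algebra finmap.
From mathcomp Require Import all_classical all_reals all_analysis.
From mathcomp Require Import lra.
From Stdlib Require Import Relation_Operators.

Set Implicit Arguments.
Unset Strict Implicit.
Unset Printing Implicit Defensive.

Import Order.TTheory GRing.Theory Num.Theory.
Import numFieldNormedType.Exports.

Local Open Scope classical_set_scope.
Local Open Scope card_scope.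
Local Open Scope ring_scope.

(* Write T(n) for the number of classes.  Stacking a translate of an m-block
   building on a highest block of an n-block building gives T(n) T(m) <= T(n + m):
   motions preserve heights up to a constant, so the n lowest blocks of the
   result, hence both classes, can be read off its class.  Conversely, a
   contiguous building of n blocks is the set of blocks visited by a walk of
   2(n - 1) attachment steps, each of boundedly many kinds up to translation, so
   T(n) <= K^n.  Fekete's lemma applied to log T concludes. *)

Local Notation space := Defs.space.

(** * Superadditive sequences and Fekete's lemma *)

Lemma superadditive_mul_le (R : realType) (u : nat -> R) :
  (forall n m, (0 < n)%N -> (0 < m)%N -> u n + u m <= u (n + m)%N) ->
  forall q m, (0 < m)%N -> (0 < q)%N -> q%:R * u m <= u (q * m)%N.
Proof.
move=> uD q m m0; elim: q => [//|[|q] IH] _; first by rewrite mul1r mul1n.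
rewrite mulSn -natr1 mulrDl mul1r addrC.
apply: le_trans (uD _ _ m0 _); last by rewrite muln_gt0.
by rewrite lerD2l IH.
Qed.

(** The limit is the supremum of the ratios [u m / m%:R], which [K] bounds. Division with remainder
    by one nearly optimal [m] forces the ratio at every large [n] to be nearly optimal too. *)
Lemma fekete (R : realType) (u : nat -> R) (K : R) :
  (forall n m, (0 < n)%N -> (0 < m)%N -> u n + u m <= u (n + m)%N) ->
  (forall n, (0 < n)%N -> 0 <= u n <= K * n%:R) ->
  exists s : R, u n / n%:R @[n --> \oo] --> s.
Proof.
move=> uD uK.
pose S := [set u n / n%:R | n in [set n | (0 < n)%N]].
have SK : ubound S K.
  move=> _ [n /= n0 <-]; have /andP[_ h] := uK _ n0.
  by rewrite ler_pdivrMr ?ltr0n.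
have supS : has_sup S by split; [exists (u 1%N / 1%:R), 1%N | exists K].
exists (sup S); apply/cvgrPdist_le => e e0.
have e20 : 0 < e / 2 by rewrite divr_gt0.
have [_ [m /= m0 <-] hm] := sup_adherent e20 supS.
have mR : 0 < m%:R :> R by rewrite ltr0n.
near=> n.
have n0 : (0 < n)%N by near: n; exists 1%N.
have nR : 0 < n%:R :> R by rewrite ltr0n.
have mn : (m <= n)%N by near: n; exists m.
(* Rounding [n] down to a multiple of [m] will cost at most this much in the ratio. *)
have Kmn : K * m%:R / n%:R <= e / 2.
  rewrite ler_pdivrMr// [e / 2 * _]mulrC -ler_pdivrMr//.
  by near: n; exact: nbhs_infty_ger.
have up : u n / n%:R <= sup S by apply: ub_le_sup; [exists K|exists n].
rewrite ger0_norm ?subr_ge0//.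
have q0 : (0 < n %/ m)%N by rewrite divn_gt0.
have uq := superadditive_mul_le uD m0 q0.
have un : (n %/ m)%:R * u m <= u n.
  apply: le_trans uq _.
  (* Superadditivity is assumed for positive indices only, so a zero remainder is treated apart;
     otherwise the remainder contributes a nonnegative term. *)
  rewrite {2}(divn_eq n m); case: (posnP (n %% m)) => [->|r0]; first by rewrite addn0.
  apply: le_trans (uD _ _ _ r0); last by rewrite muln_gt0 q0.
  by rewrite lerDl; have /andP[] := uK _ r0.
have nE : n%:R < ((n %/ m)%:R + 1) * m%:R :> R.
  by rewrite natr1 -natrM ltr_nat ltn_ceil.
have /andP[um0 umK] := uK _ m0.
(* By [nE], the factor (n - m) / m is at most the quotient [n %/ m]. *)
have k : (n%:R - m%:R) * (u m / m%:R) <= u n.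
  apply: le_trans un; rewrite mulrA mulrAC ler_wpM2r//.
  by rewrite ler_pdivrMr//; lra.
have k2 : u m / m%:R - K * m%:R / n%:R <= u n / n%:R.
  rewrite ler_pdivlMr// mulrBl divfK ?gt_eqF//.
  apply: le_trans k; rewrite mulrBl [_ * n%:R]mulrC lerD2l lerN2.
  by rewrite mulrC divfK ?gt_eqF.
lra.
Unshelve. all: by end_near.
Qed.

(** * Motions, identification, and translates of blocks and buildings *)

Lemma injective_image_setI (T U : Type) (f : T -> U) (A B : set T) :
  injective f -> f @` (A `&` B) = f @` A `&` f @` B.
Proof.
move=> finj; apply/seteqP; split; first exact: sub_image_setI.
by move=> _ [[a Aa <-] [b Bb /finj ba]]; exists a => //; split=> //; rewrite -ba.
Qed.

Lemma injective_image (T U : Type) (f : T -> U) :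
  injective f -> injective (fun A : set T => f @` A).
Proof.
move=> finj A B AB; apply/funext => x.
by rewrite -[LHS](image_inj finj) -[RHS](image_inj finj) AB.
Qed.

Section Motions.
Variable R : realType.
Implicit Types (f g : space R -> space R) (A B : set (space R)).

Lemma translation0 : translation (0, 0, 0) = id :> (space R -> space R).
Proof. by apply/funext => -[[x y] z]; rewrite /translation/= !addr0. Qed.

Definition opp_vector (v : space R) : space R := (- v.1.1, - v.1.2, - v.2).

Lemma translationK v : cancel (translation v) (@translation R (opp_vector v)).
Proof. by move=> [[x y] z]; rewrite /translation/= !addrK. Qed.

Lemma translationNK v : cancel (@translation R (opp_vector v)) (translation v).
Proof. by move=> [[x y] z]; rewrite /translation/= !subrK. Qed.

(** Inverses are not among the constructors of [motion]: a quarter turn is undone by three more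
    about the same axis. *)
Lemma motion_inverse f : motion f ->
  exists g, [/\ motion g, cancel f g & cancel g f].
Proof.
elim=> {f} [v|c|f1 f2 _ [g1 [m1 c1 d1]] _ [g2 [m2 c2 d2]]].
- by exists (translation (opp_vector v)); split;
    [exact: motion_translation|exact: translationK|exact: translationNK].
- exists (quarter_turn c \o (quarter_turn c \o quarter_turn c)); split.
  + by do 2 (apply: motion_comp; first exact: motion_quarter_turn);
      exact: motion_quarter_turn.
  + by move=> [[x y] z]; rewrite /quarter_turn/=; congr (_, _, _); lra.
  + by move=> [[x y] z]; rewrite /quarter_turn/=; congr (_, _, _); lra.
- exists (g2 \o g1); split; first exact: motion_comp.
  + exact: can_comp.
  + exact: can_comp.
Qed.

Lemma motion_shift_height f : motion f ->
  exists t : R, forall p, (f p).2 = p.2 + t.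
Proof.
elim=> {f} [v|c|f1 f2 _ [t1 h1] _ [t2 h2]].
- by exists v.2.
- by exists 0 => p; rewrite addr0.
- by exists (t2 + t1) => p; rewrite /= h1 h2 addrA.
Qed.

Lemma identified_refl (B : set (set (space R))) : identified B B.
Proof.
exists id; first by rewrite -translation0; exact: motion_translation.
by under eq_imagel do rewrite image_id; rewrite image_id.
Qed.

Lemma identified_sym (B B' : set (set (space R))) :
  identified B B' -> identified B' B.
Proof.
move=> [f /motion_inverse[g [mg fg gf]] ->]; exists g => //.
rewrite image_comp -[LHS]image_id; apply: eq_imagel => A _ /=.
by rewrite image_comp -[LHS]image_id; apply: eq_imagel => p _ /=; rewrite fg.
Qed.

Lemma identified_trans (B1 B2 B3 : set (set (space R))) :
  identified B1 B2 -> identified B2 B3 -> identified B1 B3.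
Proof.
move=> [f mf ->] [g mg ->]; exists (g \o f); first exact: motion_comp.
by rewrite image_comp; apply: eq_imagel => A _ /=; rewrite image_comp.
Qed.

Lemma building_class_identified b w n (B B' : set (set (space R))) :
  identified B B' -> building_class b w n B = building_class b w n B'.
Proof.
move=> BB'; apply/seteqP; split=> C [cC]; split => //.
  exact: identified_trans (identified_sym BB') _.
exact: identified_trans BB' _.
Qed.

(** Being a contiguous building puts [B'] in its own class, hence in that of [B]. *)
Lemma building_class_inj b w n (B B' : set (set (space R))) :
  contiguous_buildings b w n B' ->
  building_class b w n B = building_class b w n B' -> identified B B'.
Proof.
move=> cB' e; have : building_class b w n B' B' by split=> //; exact: identified_refl.
by rewrite -e => -[].
Qed.

(** Images under [f] are preimages under its continuous inverse [g], so [f] maps open sets to open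
    sets; the other inclusion is the same argument for [g]. *)
Lemma image_interior (T : topologicalType) (f g : T -> T) (A : set T) :
  continuous f -> continuous g -> cancel f g -> cancel g f ->
  (f @` A)° = f @` A°.
Proof.
move=> cf cg fg gf.
have imE (h k : T -> T) (B : set T) : cancel h k -> cancel k h -> h @` B = k @^-1` B.
  move=> hk kh; apply/seteqP; split=> [_ [p Bp <-]|p]; rewrite /preimage/= ?hk//.
  by exists (k p).
have sub (h k : T -> T) (B : set T) :
    continuous h -> continuous k -> cancel h k -> cancel k h ->
    h @` B° `<=` (h @` B)°.
  move=> ch ck hk kh; rewrite !(imE h k)//.
  have ok : open (k @^-1` B°).
    by apply: open_comp; [move=> p _; exact: ck|exact: open_interior].
  by rewrite -open_subsetE// => p; exact: interior_subset.
apply/seteqP; split; last by apply: sub cf cg fg gf.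
move=> p fAp; exists (g p) => //.
suff: (g @` (f @` A))° (g p).
  by rewrite image_comp (eq_imagel (f' := id)) ?image_id// => q _ /=; rewrite fg.
by apply: sub => //; exists p.
Qed.

Lemma translation_continuous v : continuous (@translation R v : R * R * R -> R * R * R).
Proof.
move=> p; rewrite /continuous_at.
by apply: (@cvgD _ (R * R * R)%type _ _ _ id (cst (v : R * R * R)));
  [exact: cvg_id|exact: cvg_cst].
Qed.

Lemma translation_interior v (A : set (R * R * R)) :
  (translation v @` A : set (R * R * R))° =
  (translation v : R * R * R -> R * R * R) @` A°.
Proof.
apply: image_interior (translationK v) (translationNK v);
  exact: translation_continuous.
Qed.

Definition shift (a : R * R) (p : R * R) : R * R := (p.1 + a.1, p.2 + a.2).

Lemma shift_continuous a : continuous (shift a).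
Proof.
move=> p; rewrite /continuous_at.
by apply: (@cvgD _ (R * R)%type _ _ _ id (cst a));
  [exact: cvg_id|exact: cvg_cst].
Qed.

Lemma shift_interior a (A : set (R * R)) : (shift a @` A)° = shift a @` A°.
Proof.
apply: (@image_interior _ _ (shift (- a.1, - a.2))); try exact: shift_continuous.
  by move=> [x y]; rewrite /shift/= !addrK.
by move=> [x y]; rewrite /shift/= !subrK.
Qed.

Lemma fst_translation v (A : set (space R)) :
  fst @` (translation v @` A) = shift v.1 @` (fst @` A).
Proof. by rewrite !image_comp. Qed.

Lemma shift_inj a : injective (shift a).
Proof. by move=> [x y] [x' y'] [] /addIr -> /addIr ->. Qed.

Lemma boxP dx dy x y z (p : space R) : box dx dy x y z p <->
  [/\ x%:~R <= p.1.1 <= x%:~R + dx%:R, y%:~R <= p.1.2 <= y%:~R + dy%:R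
    & z%:~R <= p.2 <= z%:~R + 1].
Proof.
rewrite /box /=; split => [[[]]|[]]; rewrite !in_itv/=.
  by move=> ? ? ?; split.
by move=> ? ? ?; split=> //; split.
Qed.

Lemma box_corner dx dy x y z : @box R dx dy x y z (x%:~R, y%:~R, z%:~R).
Proof. by apply/boxP; rewrite /= !lexx !lerDl !ler0n ler01. Qed.

Lemma box_top_corner dx dy x y z : @box R dx dy x y z (x%:~R, y%:~R, z%:~R + 1).
Proof. by apply/boxP; rewrite /= !lexx !lerDl !ler0n ler01. Qed.

Definition int_vector (i j k : int) : space R := (i%:~R, j%:~R, k%:~R).

Lemma translation_intvD i j k i' j' k' p :
  translation (int_vector i j k) (translation (int_vector i' j' k') p) =
  translation (int_vector (i + i') (j + j') (k + k')) p.
Proof. by rewrite /translation/= !intrD; congr (_, _, _); lra. Qed.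

Lemma translation_box dx dy x y z i j k :
  translation (int_vector i j k) @` box dx dy x y z =
  box dx dy (x + i) (y + j) (z + k).
Proof.
apply/seteqP; split=> [_ [p /boxP[h1 h2 h3] <-]|p /boxP[h1 h2 h3]].
  by apply/boxP; rewrite !rmorphD/=; split; lra.
exists (translation (opp_vector (int_vector i j k)) p); last exact: translationNK.
move: h1 h2 h3; rewrite !rmorphD/= => h1 h2 h3.
by apply/boxP; split=> /=; lra.
Qed.

Lemma block_translation b w z i j k (A : set (space R)) :
  block_at_height b w z A ->
  block_at_height b w (z + k) (translation (int_vector i j k) @` A).
Proof.
by move=> [x [y [|]]] ->; exists (x + i), (y + j);
  rewrite translation_box; [left|right].
Qed.

Lemma attached_translation b w i j k (A C : set (space R)) :
  attached b w A C ->
  attached b w (translation (int_vector i j k) @` A)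
               (translation (int_vector i j k) @` C).
Proof.
move=> [[z [z' [hA hC zz']]] [p hp]]; split.
  exists (z + k), (z' + k); split; [exact: block_translation..|].
  by rewrite opprD addrACA subrr addr0.
rewrite !fst_translation -injective_image_setI; last exact: shift_inj.
by rewrite shift_interior; exists (shift (int_vector i j k).1 p), p.
Qed.

Lemma translation_inj v : injective (@translation R v).
Proof. exact: can_inj (translationK v). Qed.

Lemma contiguous_buildings_translation b w n i j k (B : set (set (space R))) :
  contiguous_buildings b w n B ->
  contiguous_buildings b w n
    [set translation (int_vector i j k) @` A | A in B].
Proof.
move=> [[finB blB disB] cardB conB]; split.
- split.
  + exact: finite_image.
  + move=> _ [A BA <-]; have [z zA] := blB A BA.
    by exists (z + k); exact: block_translation.
  + move=> _ _ [A BA <-] [C BC <-] AC.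
    rewrite !translation_interior -injective_image_setI; last exact: translation_inj.
    rewrite disB ?image_set0//.
    by move=> AC'; apply: AC; rewrite AC'.
- apply: card_eq_trans cardB; apply: inj_card_eq => X Y _ _.
  by apply: injective_image; exact: translation_inj.
- move=> _ _ [A BA <-] [C BC <-].
  elim: (conB A C BA BC) => {A C BA BC} [A C [BA BC AC]|A|A C D _ h1 _ h2].
  + by apply: rt_step; split; [exists A|exists C|exact: attached_translation].
  + exact: rt_refl.
  + exact: rt_trans h1 h2.
Qed.

Lemma identified_translation (B : set (set (space R))) v :
  identified B [set translation v @` A | A in B].
Proof. by exists (translation v) => //; exact: motion_translation. Qed.

End Motions.

(** * Finite sets: cardinality, maxima and differences *)

Lemma card_eq_subset_eq (T : choiceType) (A B : set T) n :
  A #= `I_n -> B #= `I_n -> A `<=` B -> A = B.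
Proof.
move=> An Bn AB.
have finA : finite_set A by apply/finite_setP; exists n.
have finB : finite_set B by apply/finite_setP; exists n.
apply: fset_set_inj => //; apply/eqP; rewrite eqEfcard.
rewrite (card_fset_set An) (card_fset_set Bn) leqnn andbT.
by rewrite -fset_set_sub.
Qed.

Lemma card_setU_disjoint (T : choiceType) (A B : set T) n m :
  A #= `I_n -> B #= `I_m -> A `&` B = set0 -> A `|` B #= `I_(n + m).
Proof.
move=> An Bn AB.
have finA : finite_set A by apply/finite_setP; exists n.
have finB : finite_set B by apply/finite_setP; exists m.
have finU : finite_set (A `|` B) by rewrite finite_setU.
rewrite -[A `|` B]fset_setK//; apply/card_eq_fsetP.
rewrite fset_setU// cardfsU -fset_setI// AB fset_set0 cardfs0 subn0.
by rewrite (card_fset_set An) (card_fset_set Bn).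
Qed.

(** Supplies a highest block of a building and, with heights negated, a lowest one. *)
Lemma finite_set_argmax (T : Type) (A : set T) (g : T -> int) :
  finite_set A -> A !=set0 -> exists2 m, A m & forall x, A x -> g x <= g m.
Proof.
move=> finA [a0 Aa0].
have [s gs] : exists s : seq int, g @` A = [set` s].
  by have /finite_seqP := finite_image g finA.
have sg x : A x -> g x \in s.
  by move=> Ax; have : [set` s] (g x) by rewrite -gs; exists x.
have [m ms mmax] : exists2 m, m \in s & forall z, z \in s -> z <= m.
  have: g a0 \in s by exact: sg.
  elim: s {gs sg} (g a0) => // c s IH z _.
  case: s IH => [_|d s IH].
    by exists c; rewrite ?mem_head// => y; rewrite inE => /eqP ->.
  have [m ms mmax] := IH d (mem_head _ _).
  case: (leP m c) => mc.
    exists c; first exact: mem_head.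
    by move=> y; rewrite inE => /orP[/eqP ->//|/mmax ym]; exact: le_trans mc.
  exists m; first by rewrite inE ms orbT.
  by move=> y; rewrite inE => /orP[/eqP ->|/mmax//]; exact: ltW.
have [a Aa gam] : (g @` A) m by rewrite gs.
by exists a => // x /sg /mmax; rewrite gam.
Qed.

Lemma setU_disjoint_setD (T : Type) (A B : set T) :
  A `&` B = set0 -> (A `|` B) `\` A = B.
Proof. by move=> AB; rewrite setDUl setDv set0U; apply/setDidPl; rewrite setIC. Qed.

(** * Stacking one building on another, and recovering both from the result *)

Section Gluing.
Variables (R : realType) (b w : nat).
Hypotheses (b0 : (0 < b)%N) (w0 : (0 < w)%N).
Implicit Types (A X Y : set (space R)) (B C U V : set (set (space R))).

(* Motions preserve this relation, and blocks, having positive height, cannot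
   lie both below and above each other: so a building has at most one cut into
   n blocks lying below all the others. *)
Definition lower X Y := forall p q, X p -> Y q -> p.2 <= q.2.

Lemma motion_lower f X Y : motion f -> lower X Y -> lower (f @` X) (f @` Y).
Proof.
move=> /motion_shift_height[t ft] XY _ _ [p Xp <-] [q Yq <-].
by rewrite !ft lerD2r; exact: XY.
Qed.

Lemma is_block_thick X : is_block b w X -> exists p q, [/\ X p, X q & p.2 < q.2].
Proof.
move=> [z [x [y XE]]].
exists (x%:~R, y%:~R, z%:~R), (x%:~R, y%:~R, z%:~R + 1); rewrite /= ltrDl ltr01.
by case: XE => ->; split=> //; (exact: box_corner || exact: box_top_corner).
Qed.

Lemma is_block_lower_asym X Y : is_block b w X -> is_block b w Y ->
  lower X Y -> lower Y X -> False.
Proof.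
move=> /is_block_thick[p [p' [Xp Xp' pp']]] /is_block_thick[q [_ [Yq _ _]]] XY YX.
by move: (XY _ _ Xp' Yq) (YX _ _ Yq Xp); lra.
Qed.

(** If [X] were in [U] but not in [U'], equal sizes would give some [Y] in [U'] but not in [U]. Then
    [X] lies below [Y] by the first cut and above it by the second. *)
Lemma cut_unique n U V U' V' :
  U `|` V = U' `|` V' -> (forall X, (U `|` V) X -> is_block b w X) ->
  U #= `I_n -> U' #= `I_n ->
  (forall X Y, U X -> V Y -> lower X Y) ->
  (forall X Y, U' X -> V' Y -> lower X Y) ->
  U = U'.
Proof.
move=> UV bl Un U'n lUV lUV'; apply: (card_eq_subset_eq Un U'n) => X UX.
apply: contrapT => nU'X.
have CX : (U `|` V) X by left.
have V'X : V' X by move: CX; rewrite UV => -[].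
have [Y U'Y nUY] : exists2 Y, U' Y & ~ U Y.
  apply: contrapT => h; apply: nU'X; rewrite (@card_eq_subset_eq _ U' U n) //.
  by move=> Y U'Y; apply: contrapT => nUY; apply: h; exists Y.
have CY : (U `|` V) Y by rewrite UV; left.
have VY : V Y by case: CY.
by apply: (is_block_lower_asym (bl _ CX) (bl _ CY)); [exact: lUV|exact: lUV'].
Qed.

Lemma lower_disjoint U V : (forall X, U X -> is_block b w X) ->
  (forall X Y, U X -> V Y -> lower X Y) -> U `&` V = set0.
Proof.
move=> bl lUV; apply/seteqP; split=> // X [UX VX].
by apply: (is_block_lower_asym (bl _ UX) (bl _ UX)); exact: lUV.
Qed.

(** A point interior to [X] can be raised slightly within [X], above its old position in [Y]. *)
Lemma lower_interior_disjoint (X Y : set (R * R * R)) :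
  lower X Y -> X° `&` Y° = set0.
Proof.
move=> XY; apply/seteqP; split=> // p [/nbhs_ballP[e /= e0 Xe] /nbhs_singleton Yp].
have /Xe Xp : ball p e (p.1, p.2 + e / 2).
  split=> /=; first exact: ballxx.
  by rewrite /ball/= opprD addNKr normrN gtr0_norm; lra.
by have := XY _ _ Xp Yp; rewrite /=; lra.
Qed.

(** Since both sides are at least 1, the unit square at the corner lies in the bottom face for
    either orientation. *)
Lemma block_at_height_corner z X : block_at_height b w z X ->
  exists x y : int, forall p : R * R,
    x%:~R <= p.1 <= x%:~R + 1 -> y%:~R <= p.2 <= y%:~R + 1 -> X (p, z%:~R).
Proof.
have b1 : 1 <= b%:R :> R by rewrite ler1n.
have w1 : 1 <= w%:R :> R by rewrite ler1n.
move=> [x [y XE]]; exists x, y => p hx hy.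
by case: XE => ->; apply/boxP; split=> /=; lra.
Qed.

Lemma block_at_height_le z X p : block_at_height b w z X -> X p ->
  z%:~R <= p.2 <= z%:~R + 1.
Proof. by move=> [x [y [|]]] -> /boxP[]. Qed.

Lemma attached_sym X Y : attached b w X Y -> attached b w Y X.
Proof.
move=> [[z [z' [hX hY zz']]] XY]; split; last by rewrite setIC.
by exists z', z; split; rewrite // distrC.
Qed.

(** Move [Y] one level up with its corner above that of [X]. The projections then share a unit
    square, whose centre is an interior point. *)
Lemma attached_over z X Y : block_at_height b w z X -> block_at_height b w z Y ->
  exists i j : int, attached b w X (translation (int_vector R i j 1) @` Y).
Proof.
move=> hX hY.
have [x [y Xxy]] := block_at_height_corner hX.
have [x' [y' Yxy]] := block_at_height_corner hY.
exists (x - x'), (y - y'); split.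
  exists z, (z + 1); split=> //; first exact: block_translation.
  by rewrite opprD addrA subrr sub0r normrN1.
exists (x%:~R + 1 / 2, y%:~R + 1 / 2) => /=.
apply/nbhs_ballP; exists (1 / 2) => /=; first lra.
move=> p [/= px py].
have {}px : x%:~R <= p.1 <= x%:~R + 1.
  by move: px; rewrite /ball/= ltr_norml; lra.
have {}py : y%:~R <= p.2 <= y%:~R + 1.
  by move: py; rewrite /ball/= ltr_norml; lra.
split; first by exists (p, z%:~R) => //; exact: Xxy.
exists (translation (int_vector R (x - x') (y - y') 1)
  (p.1 - (x - x')%:~R, p.2 - (y - y')%:~R, z%:~R)).
  by eexists; last reflexivity; apply: Yxy; rewrite /= !rmorphB/=; lra.
by rewrite /translation/= !subrK; case: (p).
Qed.

Lemma contiguous_sub B C X Y : B `<=` C ->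
  clos_refl_trans (set (space R))
    (fun A1 A2 => [/\ B A1, B A2 & attached b w A1 A2]) X Y ->
  clos_refl_trans (set (space R))
    (fun A1 A2 => [/\ C A1, C A2 & attached b w A1 A2]) X Y.
Proof.
move=> BC; elim=> {X Y} [X Y [BX BY XY]|X|X Y Z _ h1 _ h2].
- by apply: rt_step; split=> //; exact: BC.
- exact: rt_refl.
- exact: rt_trans h1 h2.
Qed.

Lemma glue_buildings n m U V : (0 < n)%N -> (0 < m)%N ->
  contiguous_buildings b w n U -> contiguous_buildings b w m V ->
  exists V', [/\ contiguous_buildings b w m V', identified V V',
    contiguous_buildings b w (n + m) (U `|` V') &
    forall X Y, U X -> V' Y -> lower X Y].
Proof.
move=> n0 m0 cU cV.
have [[finU blU disU] cardU conU] := cU.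
have [[finV blV disV] cardV conV] := cV.
have ne k (B : set (set (space R))) : (0 < k)%N -> B #= `I_k -> B !=set0.
  move=> k0 Bk; apply/set0P/eqP => B0.
  by have := card_fset_set Bk; rewrite B0 fset_set0 cardfs0 => k00; rewrite -k00 in k0.
have Une := ne _ _ n0 cardU.
have Vne := ne _ _ m0 cardV.
(* A chosen height for each block; the default 0 occurs only for sets that are not blocks. *)
pose ht (X : set (space R)) : int := xget 0 [set z | block_at_height b w z X].
have htP X : is_block b w X -> block_at_height b w (ht X) X.
  move=> [z hz].
  by apply: (@xgetPex _ 0 [set t | block_at_height b w t X]); exists z.
have [P UP Pmax] := finite_set_argmax ht finU Une.
have [Q VQ Qmin] := finite_set_argmax (fun X => - ht X) finV Vne.
have hP := htP _ (blU _ UP).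
pose d : int := ht P - ht Q.
(* The lowest block [Q] of [V] is first brought level with the highest block [P] of [U];
   [attached_over] then lifts it onto [P]. *)
have hQ : block_at_height b w (ht P) (translation (int_vector R 0 0 d) @` Q).
  rewrite (_ : ht P = ht Q + d); last by rewrite addrC subrK.
  by apply: block_translation; exact/htP/blV.
have [i [j PQ]] := attached_over hP hQ.
set v := int_vector R (i + 0) (j + 0) (1 + d).
have {}PQ : attached b w P (translation v @` Q).
  move: PQ; rewrite image_comp (eq_imagel (f' := translation v))// => p _.
  exact: translation_intvD.
pose V' := [set translation v @` A | A in V].
have cV' : contiguous_buildings b w m V' by exact: contiguous_buildings_translation.
(* The plane at height [ht P + 1] separates [U] from the translated [V]. *)
have lUV : forall X Y, U X -> V' Y -> lower X Y.
  move=> X _ UX [Y VY <-] p _ Xp [q Yq <-].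
  have := block_at_height_le (htP _ (blU _ UX)) Xp.
  have := block_at_height_le (htP _ (blV _ VY)) Yq.
  have : (ht X)%:~R <= (ht P)%:~R :> R by rewrite ler_int; exact: Pmax.
  have : (ht Q)%:~R <= (ht Y)%:~R :> R.
    by rewrite ler_int -lerN2; exact: Qmin.
  by rewrite /translation/= /d !intrD rmorphN/=; lra.
exists V'; split=> //; first exact: identified_translation.
have [[finV' blV' disV'] cardV' conV'] := cV'.
split.
- split; first by rewrite finite_setU.
  + by move=> X [/blU|/blV'].
  + move=> X Y [UX|VX] [UY|VY] XY; [exact: disU| | |exact: disV'].
      by apply: lower_interior_disjoint; exact: lUV.
    by rewrite setIC; apply: lower_interior_disjoint; exact: lUV.
- by apply: card_setU_disjoint => //; exact: lower_disjoint lUV.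
- have V'Q : V' (translation v @` Q) by exists Q.
  have sU := @contiguous_sub U (U `|` V') _ _ (@subsetUl _ _ _).
  have sV := @contiguous_sub V' (U `|` V') _ _ (@subsetUr _ _ _).
  (* Chains between the two halves pass through the attached pair formed by [P] and the translate of
     [Q]. *)
  move=> X Y [UX|VX] [UY|VY].
  + by apply: sU; exact: conU.
  + apply: rt_trans (sU _ _ (conU _ _ UX UP)) _.
    apply: rt_trans (sV _ _ (conV' _ _ V'Q VY)).
    by apply: rt_step; split=> //; [left|right].
  + apply: rt_trans (sV _ _ (conV' _ _ VX V'Q)) _.
    apply: rt_trans (sU _ _ (conU _ _ UP UY)).
    by apply: rt_step; split=> //; [right|left|exact: attached_sym].
  + by apply: sV; exact: conV'.
Qed.

(** The motion carries the first cut to a cut of [U']|[V'] with [n] lower blocks; by uniqueness that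
    is the second cut, so the same motion identifies both halves. *)
Lemma identified_cut n U V U' V' :
  (forall X, (U' `|` V') X -> is_block b w X) ->
  U #= `I_n -> U' #= `I_n ->
  (forall X Y, U X -> V Y -> lower X Y) ->
  (forall X Y, U' X -> V' Y -> lower X Y) ->
  U `&` V = set0 -> U' `&` V' = set0 ->
  identified (U `|` V) (U' `|` V') -> identified U U' /\ identified V V'.
Proof.
move=> bl Un U'n lUV lUV' UV0 UV0' [f mf]; rewrite image_setU => e.
have [g [_ fg _]] := motion_inverse mf.
have finj := injective_image (can_inj fg).
have eU : [set f @` X | X in U] = U'.
  apply: (@cut_unique n _ [set f @` X | X in V] _ V') => //.
  - by rewrite -e.
  - by apply: card_eq_trans Un; apply: inj_card_eq => X Y _ _; exact: finj.
  - by move=> _ _ [X UX <-] [Y VY <-]; apply: motion_lower => //; exact: lUV.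
have eV : [set f @` X | X in V] = V'.
  rewrite -(setU_disjoint_setD UV0') e -eU setU_disjoint_setD//.
  by rewrite -injective_image_setI// UV0 image_set0.
by split; exists f.
Qed.

End Gluing.

(** * Encoding buildings by walks: finiteness and the exponential upper bound *)

Lemma clos_refl_trans_crossing (T : Type) (r : T -> T -> Prop) (S : set T) x y :
  clos_refl_trans T r x y -> S x -> ~ S y ->
  exists u v, [/\ r u v, S u & ~ S v].
Proof.
move=> xy Sx nSy; apply: contrapT => h; apply: nSy.
elim: xy Sx => {x y} [x y rxy Sx|//|x y z _ h1 _ h2 /h1/h2//].
by apply: contrapT => nSy; apply: h; exists x, y.
Qed.

(** On reaching [u], go to [v] and straight back, then continue as before. *)
Lemma splice_detour (T : eqType) (r : rel T) (x u v : T) (s : seq T) :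
  path r x s -> u \in x :: s -> r u v -> r v u ->
  exists s', [/\ path r x s', size s' = (size s).+2 &
    x :: s' =i v :: x :: s].
Proof.
move=> rs us ruv rvu; move: rs; case/splitPl: us => p1 p2 p1u.
rewrite cat_path p1u => /andP[rp1 rp2].
exists (p1 ++ v :: u :: p2); split.
- by rewrite cat_path p1u /= rp1 ruv rvu.
- by rewrite !size_cat /= !addnS.
- have : u \in x :: p1 by rewrite -p1u mem_last.
  move=> up y; have h : y == u -> (y == x) || (y \in p1).
    by move=> /eqP ->; rewrite -in_cons.
  rewrite !inE !mem_cat !inE.
  by case: (y == u) h => [/(_ isT)|_]; case: (y == x); case: (y \in p1);
    case: (y == v).
Qed.

Lemma int_offset (N : nat) (u v : int) : `|v - u| <= N%:Z ->
  exists i : 'I_(N.*2.+1), v = u + i%:Z - N%:Z.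
Proof.
rewrite ler_norml => /andP[h1 h2].
have d0 : 0 <= v - u + N%:Z by rewrite -lerBlDr sub0r.
have dN : (absz (v - u + N%:Z)%R < N.*2.+1)%N.
  by rewrite ltnS -lez_nat gez0_abs// -addnn PoszD lerD2r.
by exists (Ordinal dN); rewrite /= gez0_abs// addrA [u + _]addrC subrK addrK.
Qed.

Lemma mem_seq_fset (T : choiceType) (s : seq T) (x : T) :
  (x \in [fset y in s]%fset) = (x \in s).
Proof. by rewrite inE. Qed.

Section Walks.
Variables (R : realType) (b w : nat).
Implicit Types (X Y : set (space R)) (B : set (set (space R))).

Definition brick (c : bool * (int * int * int)) : set (space R) :=
  let: (o, (x, y, z)) := c in if o then box b w x y z else box w b x y z.

(* Bounds the displacement between the corners of two attached blocks.  The
   vertical slack 3 avoids proving that a block determines its height. *)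
Definition reach : nat := b + w + 3.

Definition steps : finType :=
  (bool * ('I_(reach.*2.+1) * 'I_(reach.*2.+1) * 'I_(reach.*2.+1)))%type.

(** The ordinals encode signed displacements centred at [reach]; the orientation of the new block is
    given outright. *)
Definition step (c : bool * (int * int * int)) (d : steps) :
    bool * (int * int * int) :=
  let: (_, (x, y, z)) := c in let: (o, (i, j, k)) := d in
  (o, (x + i%:Z - reach%:Z, y + j%:Z - reach%:Z, z + k%:Z - reach%:Z)).

Lemma brick_bounds o x y z p : brick (o, (x, y, z)) p ->
  [/\ x%:~R <= p.1.1 <= x%:~R + (b + w)%:R,
      y%:~R <= p.1.2 <= y%:~R + (b + w)%:R &
      z%:~R <= p.2 <= z%:~R + 1].
Proof.
have b0 : 0 <= b%:R :> R by rewrite ler0n.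
have w0 : 0 <= w%:R :> R by rewrite ler0n.
by rewrite natrD; case: o => /= /boxP[]; split; lra.
Qed.

Lemma is_blockP X : is_block b w X <-> exists c, X = brick c.
Proof.
split=> [[z [x [y [|]]]] ->|[[[] [[x y] z]] ->]].
- by exists (true, (x, y, z)).
- by exists (false, (x, y, z)).
- by exists z, x, y; left.
- by exists z, x, y; right.
Qed.

(** A common point of the two projections confines the horizontal displacement of the corners to
    [b + w]. *)
Lemma attached_step c Y : attached b w (brick c) Y ->
  exists d, Y = brick (step c d).
Proof.
case: c => o [[x y] z] [[z1 [z' [hX hY zz']]] [a /nbhs_singleton[[p Xp pa] [q Yq qa]]]].
have [x1 [y1 hX1]] := hX.
have z1p : z1%:~R <= p.2 <= z1%:~R + 1.
  by move: Xp; case: hX1 => -> /boxP[].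
have [px py pz] := brick_bounds Xp.
have [e' [x' [y' YE]]] : exists e' x' y', Y = brick (e', (x', y', z')).
  by have [x' [y' [|]]] := hY; [exists true, x', y'|exists false, x', y'].
have [qx qy qz] : [/\ x'%:~R <= p.1.1 <= x'%:~R + (b + w)%:R,
      y'%:~R <= p.1.2 <= y'%:~R + (b + w)%:R & z'%:~R <= q.2 <= z'%:~R + 1].
  by rewrite pa -qa; apply: (@brick_bounds e'); rewrite -YE.
have dx : `|x' - x| <= (b + w)%:Z.
  by rewrite -(ler_int R) intr_norm rmorphB/= ler_norml; lra.
have dy : `|y' - y| <= (b + w)%:Z.
  by rewrite -(ler_int R) intr_norm rmorphB/= ler_norml; lra.
(* The point [p] lies in the block described both at height [z] and at height [z1]; hence [z'] is
   within 2 of [z]. *)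
have dz : `|z1 - z| <= 1.
  by rewrite -(ler_int R) intr_norm rmorphB/= ler_norml; lra.
have bw_reach : (b + w)%:Z <= reach%:Z by rewrite lez_nat leq_addr.
have [i iE] := int_offset (le_trans dx bw_reach).
have [j jE] := int_offset (le_trans dy bw_reach).
have dz' : `|z' - z| <= reach%:Z.
  apply: le_trans (ler_distD z1 _ _) _; rewrite distrC zz'.
  by apply: le_trans (lerD (lexx 1) dz) _; rewrite lez_nat /reach addn3.
have [k kE] := int_offset dz'.
by exists (e', (i, j, k)); rewrite YE iE jE kE.
Qed.

Local Notation att := (fun X Y => `[< attached b w X Y >]).

Lemma path_steps c s : path att (brick c) s ->
  exists2 t : seq steps, size t = size s & s = map brick (scanl step c t).
Proof.
elim: s c => [|Y s IH] c /=; first by exists [::].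
move=> /andP[/asboolP/attached_step[d ->] /IH[t ts ->]].
by exists (d :: t); rewrite /= ?size_map ?size_scanl.
Qed.

(** While some block is unvisited, contiguity yields an attachment from a visited block to an
    unvisited one. A detour along it adds two steps and exactly one new block. *)
Lemma contiguous_walk n B X k : contiguous_buildings b w n B -> B X ->
  (k < n)%N -> exists s, [/\ path att X s, size s = k.*2,
    {in X :: s, forall Y, B Y} & #|` [fset Y in X :: s]%fset| = k.+1].
Proof.
move=> [[finB blB disB] cardB conB] BX.
elim: k => [_|k IH kn].
  exists [::]; split=> //; first by move=> Y; rewrite inE => /eqP ->.
  have -> : [fset Y in [:: X]]%fset = [fset X]%fset.
    by apply/fsetP => Y; rewrite mem_seq_fset !inE.
  exact: cardfs1.
have [s [ps ss sB sk]] := IH (ltnW kn).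
have [Q BQ nsQ] : exists2 Q, B Q & Q \notin X :: s.
  apply: contrapT => h; move: kn.
  suff -> : n = k.+1 by rewrite ltnn.
  rewrite -sk -(card_fset_set cardB); congr #|` _|.
  apply/fsetP => Y; rewrite in_fset_set// mem_seq_fset.
  apply/idP/idP => [|/sB BY]; last by rewrite inE.
  rewrite inE => BY; apply: contrapT => nY; apply: h; exists Y => //.
  exact/negP.
have [u [v [[Bu Bv uv] us vs]]] := clos_refl_trans_crossing
  (S := [set Y | Y \in X :: s]) (conB _ _ BX BQ) (mem_head _ _) (elimN idP nsQ).
have [s' [ps' ss' s'E]] := splice_detour ps us (asboolT uv) (asboolT (attached_sym uv)).
exists s'; split=> //.
- by rewrite ss' ss.
- by move=> Y; rewrite s'E inE => /orP[/eqP ->//|/sB].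
- have -> : [fset Y in X :: s']%fset = (v |` [fset Y in X :: s])%fset.
    by apply/fsetP => Y; rewrite in_fset1U !mem_seq_fset s'E inE.
  rewrite cardfsU1 sk; have -> // : v \notin [fset Y in X :: s]%fset.
  by apply/negP; rewrite mem_seq_fset => /vs.
Qed.

(** The blocks visited by a walk whose first block has its corner at the origin. An arbitrary [d]
    may revisit blocks or make them overlap, so counting codes gives an upper bound. *)
Definition decode n (d : bool * (n.*2).-tuple steps) : set (set (space R)) :=
  let c := (d.1, (0, 0, 0)) in [set` brick c :: map brick (scanl step c d.2)].

Lemma translation_brick o x y z i j k :
  translation (int_vector R i j k) @` brick (o, (x, y, z)) =
  brick (o, (x + i, y + j, z + k)).
Proof. by case: o => /=; rewrite translation_box. Qed.

Lemma contiguous_buildings_decode n B : contiguous_buildings b w n.+1 B ->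
  exists d, identified B (decode (n := n) d).
Proof.
move=> cB; have [[finB blB _] cardB _] := cB.
have [X0 BX0] : B !=set0.
  apply/set0P/eqP => B0.
  by have := card_fset_set cardB; rewrite B0 fset_set0 cardfs0.
have [[e [[x y] z]] X0E] := (is_blockP X0).1 (blB _ BX0).
have cB1 := contiguous_buildings_translation (- x) (- y) (- z) cB.
have BB1 := identified_translation B (int_vector R (- x) (- y) (- z)).
set B1 := [set _ | _ in B] in cB1 BB1.
have BX1 : B1 (brick (e, (0, 0, 0))).
  by exists X0 => //; rewrite X0E translation_brick !subrr.
have [s [ps ss sB sn]] := contiguous_walk cB1 BX1 (ltnSn n).
have [t ts sE] := path_steps ps.
have tn : size t == n.*2 by rewrite ts ss.
(* The visited blocks form a subset of [B1] with the full [n.+1] elements. *)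
exists (e, Tuple tn); rewrite (_ : decode _ = B1)//.
rewrite /decode/= -sE; apply: (@card_eq_subset_eq _ _ _ n.+1).
- have -> : [set` brick (e, (0, 0, 0)) :: s] =
      [set` [fset Y in brick (e, (0%R, 0%R, 0%R)) :: s]%fset].
    by apply/funext => Y /=; rewrite mem_seq_fset.
  exact/card_eq_fsetP.
- by have [] := cB1.
- by move=> Y /= /sB.
Qed.

Lemma building_classes_decode n :
  building_classes b w n.+1 `<=`
  [set building_class b w n.+1 (decode d) | d in [set: bool * (n.*2).-tuple steps]].
Proof.
move=> _ [B cB <-]; have [d Bd] := contiguous_buildings_decode cB.
by exists d => //; apply/esym; exact: building_class_identified.
Qed.

Lemma finite_building_classes n : finite_set (@building_classes R b w n.+1).
Proof.
apply: sub_finite_set (@building_classes_decode n) _.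
exact/finite_image/finite_finset.
Qed.

Lemma num_buildings_le n :
  (num_buildings R b w n.+1 <= 2 * #|steps| ^ n.*2)%N.
Proof.
have h := @building_classes_decode n.
have fi := finite_image (fun d => building_class b w n.+1 (decode d))
  (@finite_finset _ [set: bool * (n.*2).-tuple steps]).
rewrite /num_buildings.
apply: leq_trans (fsubset_leq_card (_ : (_ `<=` fset_set _)%fset)) _.
  by rewrite -fset_set_sub; [exact: h|exact: finite_building_classes|exact: fi].
rewrite fset_set_image; last exact: finite_finset.
apply: leq_trans (leq_imfset_card _ _ _) _.
have -> : (2 * #|steps| ^ n.*2 = #|{: bool * (n.*2).-tuple steps}|)%N.
  by rewrite [RHS]card_prod card_bool card_tuple.
rewrite cardE; apply: uniq_leq_size; first exact: fset_uniq.
by move=> x _; rewrite mem_enum.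
Qed.

End Walks.

(** * Supermultiplicativity and positivity of the counts *)

Lemma cardfsM (T U : choiceType) (A : {fset T}) (B : {fset U}) :
  #|` (A `*` B)%fset| = (#|` A| * #|` B|)%N.
Proof.
rewrite -(size_allpairs pair); apply: perm_size; apply: uniq_perm => [||[x y]].
- exact: fset_uniq.
- by apply: allpairs_uniq; rewrite ?fset_uniq// => -[? ?] [].
- by rewrite in_fsetM; apply/idP/allpairsP => [/andP[xA yB]|[[x' y'] [/= xA yB [-> ->]]]];
    [exists (x, y)|rewrite xA].
Qed.

Section Counting.
Variables (R : realType) (b w : nat).
Hypotheses (b0 : (0 < b)%N) (w0 : (0 < w)%N).

(** Choosing representatives and a gluing for each pair of classes is injective up to
    identification, by [identified_cut]. *)
Lemma num_buildings_mul_le n m : (0 < n)%N -> (0 < m)%N ->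
  (num_buildings R b w n * num_buildings R b w m <= num_buildings R b w (n + m))%N.
Proof.
move=> n0 m0.
have fin k : (0 < k)%N -> finite_set (@building_classes R b w k).
  by case: k => // k _; exact: finite_building_classes.
pose glued (CD : set (set (set (space R))) * set (set (set (space R)))) W :=
  exists U V V', [/\ contiguous_buildings b w n U, building_class b w n U = CD.1,
    building_class b w m V = CD.2 &
    [/\ contiguous_buildings b w m V', identified V V', W = U `|` V',
    contiguous_buildings b w (n + m) W & forall X Y, U X -> V' Y -> lower X Y]].
(* On [S] a gluing always exists, so the default [set0] is taken only outside [S]. *)
pose f CD := building_class b w (n + m) (xget set0 [set W | glued CD W]).
pose S := @building_classes R b w n `*` @building_classes R b w m.
have fP CD : S CD -> glued CD (xget set0 [set W | glued CD W]).
  move=> [[U cU UE] [V cV VE]]; apply: (@xgetPex _ set0 [set W | glued CD W]).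
  have [V' [cV' VV' cW lW]] := glue_buildings b0 w0 n0 m0 cU cV.
  by exists (U `|` V'), U, V, V'.
have finS : finite_set S by apply: finite_setX; exact: fin.
have finj : {in fset_set S &, injective f}.
  move=> CD CD'; rewrite !in_fset_set// !inE /f => /fP + /fP.
  move: (xget _ [set W | glued CD W]) (xget _ [set W | glued CD' W]) => W W'.
  move=> [U [V0 [V [[[_ blU _] cardU _] UE V0E [[[_ blV _] _ _] VV0 -> cW lW]]]]].
  move=> [U' [V0' [V' [[[_ blU' _] cardU' _] UE' V0E' [_ VV0' -> cW' lW']]]]].
  move=> /(building_class_inj cW') WW'.
  have [[_ blW' _] _ _] := cW'.
  have [UU' VV'] := identified_cut blW' cardU cardU' lW lW'
    (lower_disjoint blU lW) (lower_disjoint blU' lW') WW'.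
  rewrite [CD]surjective_pairing [CD']surjective_pairing -UE -UE' -V0E -V0E'.
  congr (_, _); first exact: building_class_identified.
  (* The upper halves are only identified with the representatives [V0] and [V0'], hence the chain
     from [V0] through [V] and [V'] to [V0']. *)
  apply: building_class_identified; apply: identified_trans VV0 _.
  exact: identified_trans VV' (identified_sym VV0').
rewrite /num_buildings -cardfsM -fset_setX; [|exact: fin..].
rewrite -(card_in_imfset imfset_key finj).
apply: fsubset_leq_card; apply/fsubsetP => _ /imfsetP[CD /= + ->].
rewrite in_fset_set// inE => /fP[U [V [V' [_ _ _ [_ _ _ cW _]]]]].
rewrite in_fset_set; first by rewrite inE; exists (xget set0 [set W | glued CD W]).
by apply: fin; rewrite addn_gt0 n0.
Qed.

Lemma contiguous_building1 :
  contiguous_buildings b w 1 [set box b w 0 0 0 : set (space R)].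
Proof.
split; last by move=> A C -> ->; exact: rt_refl.
- split => //.
  + by move=> A ->; exists 0, 0, 0; left.
  + by move=> A C -> ->.
- exact: card_set1.
Qed.

(** A single block settles [n = 1]; supermultiplicativity then adds one block at a time. *)
Lemma num_buildings_gt0 n : (0 < n)%N -> (0 < num_buildings R b w n)%N.
Proof.
have T1 : (0 < num_buildings R b w 1)%N.
  rewrite /num_buildings cardfs_gt0; apply/fset0Pn.
  exists (building_class b w 1 [set box b w 0 0 0 : set (space R)]).
  rewrite in_fset_set ?inE; last exact: finite_building_classes.
  by exists [set box b w 0 0 0] => //; exact: contiguous_building1.
case: n => // n _; elim: n => // n IH.
apply: leq_trans (num_buildings_mul_le (ltn0Sn 0) (ltn0Sn n)).
by rewrite muln_gt0 T1.
Qed.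

End Counting.

Theorem theorem2p9 (R : realType) (b w : nat) (hb : (0 < b)%N) (hw : (0 < w)%N) :
  exists s : R, ln ((num_buildings R b w n)%:R : R) / n%:R @[n --> \oo] --> s.
Proof.
(* A factor 2 for the initial orientation and two steps per block: [K ^ n.+1] dominates the bound of
   [num_buildings_le]. *)
pose K := (2 * #|steps b w| ^ 2)%N.
have T0 n : (0 < n)%N -> 0 < (num_buildings R b w n)%:R :> R.
  by move=> n0; rewrite ltr0n num_buildings_gt0.
have steps_gt0 : (0 < #|steps b w|)%N.
  by apply/card_gt0P; exists (true, (ord0, ord0, ord0)).
have K0 : (0 < K)%N by rewrite muln_gt0 expn_gt0 steps_gt0.
apply: (@fekete _ _ (ln (K%:R))) => [n m n0 m0|[//|n] _].
  rewrite -lnM ?posrE ?T0// ler_ln ?posrE ?mulr_gt0 ?T0 ?addn_gt0 ?n0//.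
  by rewrite -natrM ler_nat num_buildings_mul_le.
rewrite ln_ge0 ?ler1n ?num_buildings_gt0//=.
rewrite mulr_natr -lnXn ?ltr0n// ler_ln ?posrE ?T0// -?natrX ?ltr0n ?expn_gt0 ?K0//.
rewrite ler_nat; apply: leq_trans (num_buildings_le R b w n) _.
rewrite /K expnMn -expnM leq_mul//; first by rewrite -{1}(expn1 2) leq_exp2l.
by rewrite leq_pexp2l// mul2n leq_double.
Qed.
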